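(* Let $P=P^*\in L(\mathcal H)$ be a bounded self-adjoint operator and let $(x_e,u_e)\in\operatorname{dom}A\times\mathcal U$ be a controlled equilibrium. Then the following statements are equivalent: (i) There exist $\gamma>0$ and $w\in\mathcal H$ such that the optimal control problem (OCP) is strictly pre-dissipative at $(x_e,u_e)$ with storage function $V_{\gamma P,w}(x)=\langle \gamma Px,x\rangle+2\operatorname{Re}\langle w,x\rangle$. (ii) One has $$\begin{bmatrix} z+C^*Cx_e\\ v+K^*Ku_e\end{bmatrix}\in\operatorname{ran}\begin{bmatrix} A^* \\ B^* \end{bmatrix},$$ i.e., there exists $\tilde w\in\operatorname{dom}A^*$ with $A^*\tilde w=z+C^*Cx_e$ and $B^*\tilde w=v+K^*Ku_e$, and there exist $\eta,m>0$ such that for all $x\in\operatorname{dom}A$ $$\|Cx\|^2-2\eta\operatorname{Re}\langle Ax,Px\rangle\ \ge\ m\|x\|^2 .$$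
   Context: Setting: $\mathcal H,\mathcal U,\mathcal Y,\mathcal Z$ are Hilbert spaces (real or complex, over the same field), $A$ generates a $C_0$-semigroup on $\mathcal H$, and $B\in L(\mathcal U,\mathcal H)$, $C\in L(\mathcal H,\mathcal Y)$, $K\in L(\mathcal U,\mathcal Z)$ are bounded linear operators, $z\in\mathcal H$, $v\in\mathcal U$. It is assumed that there is $c_K>0$ with $\|Ku\|\ge c_K\|Bu\|$ for all $u\in\mathcal U$. The optimal control problem (OCP) is $$\min_{u\in L^2(0,T;\mathcal U)}\int_0^T\ell(x,u)\,dt\quad\text{s.t. }\dot x=Ax+Bu,\ x(0)=x_0,$$ with $\ell(x,u)=\|Cx\|^2+\|Ku\|^2+2\operatorname{Re}\langle z,x\rangle+2\operatorname{Re}\langle v,u\rangle$. A controlled equilibrium is a pair $(x_e,u_e)\in\operatorname{dom}A\times\mathcal U$ with $Ax_e+Bu_e=0$. $\mathcal K$ is the set of continuous strictly increasing functions $\alpha:[0,\infty)\to[0,\infty)$ with $\alpha(0)=0$. A storage function is a (Fréchet, real-linear derivative) $C^1$-function $V:\mathcal H\to\mathbb R$. The OCP is strictly pre-dissipative at a controlled equilibrium $(x_e,u_e)$ with storage function $V$ if there is a dissipation rate $\alpha\in\mathcal K$ such that for all $x\in\operatorname{dom}A$ and $u\in\mathcal U$: $V'(x)(Ax+Bu)\le\ell(x,u)-\ell(x_e,u_e)-\alpha(\|x-x_e\|)$. *)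

(* Defs.v *)
From HB Require Import structures.
From mathcomp Require Import all_boot all_order all_algebra sesquilinear.
From mathcomp Require Import complex.
From mathcomp Require Import boolp classical_sets functions reals.
From mathcomp Require Import topology normedtype landau derive.

Set Implicit Arguments.
Unset Strict Implicit.
Unset Printing Implicit Defensive.

Import Order.TTheory GRing.Theory Num.Theory.
Import numFieldNormedType.Exports.

Local Open Scope classical_set_scope.
Local Open Scope ring_scope.
Local Open Scope complex_scope.

Variant scalar_kind := RealScalars | ComplexScalars.

Definition scalar_field (R : realType) (k : scalar_kind) : numFieldType :=
  match k with RealScalars => R | ComplexScalars => R[i] end.

Section Scalars.
Context {R : realType} {k : scalar_kind}.

Definition scalar_conj : scalar_field R k -> scalar_field R k :=
  match k with RealScalars => idfun | ComplexScalars => @conjc R end.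

Definition scalar_Re : scalar_field R k -> R :=
  match k with RealScalars => idfun | ComplexScalars => @complex.Re R end.

Definition of_real : R -> scalar_field R k :=
  match k with RealScalars => idfun | ComplexScalars => real_complex R end.

Fact scalar_conj_is_zmod_morphism : zmod_morphism scalar_conj.
Proof. by rewrite /scalar_conj; case: k => // x y; exact: rmorphB. Qed.

Fact scalar_conj_is_monoid_morphism : monoid_morphism scalar_conj.
Proof.
rewrite /scalar_conj; by case: k; split=> // [|x y]; [exact: rmorph1 | exact: rmorphM].
Qed.

HB.instance Definition _ :=
  GRing.isZmodMorphism.Build _ _ scalar_conj scalar_conj_is_zmod_morphism.
HB.instance Definition _ :=
  GRing.isMonoidMorphism.Build _ _ scalar_conj scalar_conj_is_monoid_morphism.

Fact of_real_is_zmod_morphism : zmod_morphism of_real.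
Proof. by rewrite /of_real; case: k => // x y; exact: rmorphB. Qed.

Fact of_real_is_monoid_morphism : monoid_morphism of_real.
Proof.
rewrite /of_real; by case: k; split=> // x y; exact: rmorphM.
Qed.

HB.instance Definition _ :=
  GRing.isZmodMorphism.Build _ _ of_real of_real_is_zmod_morphism.
HB.instance Definition _ :=
  GRing.isMonoidMorphism.Build _ _ of_real of_real_is_monoid_morphism.

Fact scalar_ReD : {morph scalar_Re : x y / x + y}.
Proof. by rewrite /scalar_Re; case: k => // -[? ?] [? ?]. Qed.

Fact scalar_Re_normM (x y : scalar_field R k) :
  scalar_Re (`|x| * y) = scalar_Re `|x| * scalar_Re y.
Proof.
rewrite /scalar_Re; case: k x y => [x y|x [a b]]; first by [].
by rewrite (normc_def x) /= mul0r subr0.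
Qed.

Fact scalar_Re_of_real a : scalar_Re (of_real a) = a.
Proof. by rewrite /scalar_Re /of_real; case: k. Qed.

Fact norm_of_real a : `|of_real a| = of_real `|a|.
Proof.
rewrite /of_real; case: k => //.
by rewrite (normc_def a%:C) /= expr0n addr0 sqrtr_sqr.
Qed.

Fact scalar_Re_le : {homo scalar_Re : x y / x <= y}.
Proof. by rewrite /scalar_Re; case: k => // x y; rewrite (lecE x y) => /andP[]. Qed.

Fact ge0_scalar_ReK (x : scalar_field R k) : 0 <= x -> of_real (scalar_Re x) = x.
Proof.
rewrite /scalar_Re /of_real; case: k x => // -[a b].
by rewrite (lecE 0 (a +i* b)) => /andP[/eqP /= ->].
Qed.

End Scalars.

(* [inner] is linear in its first and conjugate-linear in its second argument.
   As in every [normedModType K], the norm takes its (real) values in [K]. *)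
HB.mixin Record CompleteNormedModule_isHilbert (R : realType) (k : scalar_kind) H
    & CompleteNormedModule (scalar_field R k) H := {
  inner : {dot H for @scalar_conj R k};
  inner_normE : forall x : H, `|x| ^+ 2 = inner x x
}.

#[short(type="hilbertType")]
HB.structure Definition Hilbert (R : realType) (k : scalar_kind) :=
  {H of CompleteNormedModule (scalar_field R k) H &
        CompleteNormedModule_isHilbert R k H}.

Section RealNorm.
Context {R : realType} {k : scalar_kind}.

Definition rnorm {H : normedModType (scalar_field R k)} (x : H) : R :=
  scalar_Re `|x|.

(* [H] with scalar multiplication restricted to the reals and real-valued norm:
   the real normed space underlying [H], in which a function [H -> R] is
   differentiated. *)
Definition realified (H : normedModType (scalar_field R k)) : Type := H.

End RealNorm.

Section Realified.
Context {R : realType} {k : scalar_kind} (H : normedModType (scalar_field R k)).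

HB.instance Definition _ := GRing.Zmodule.copy (realified H) H.

Let rscale (a : R) (x : realified H) : realified H := of_real a *: (x : H).

Let rscaleA a b x : rscale a (rscale b x) = rscale (a * b) x.
Proof. by rewrite /rscale scalerA -rmorphM. Qed.

Let rscale1 : left_id 1 rscale.
Proof. by move=> x; rewrite /rscale rmorph1 scale1r. Qed.

Let rscaleDr : right_distributive rscale +%R.
Proof. by move=> a x y; rewrite /rscale scalerDr. Qed.

Let rscaleDl x : {morph rscale^~ x : a b / a + b}.
Proof. by move=> a b; rewrite /rscale rmorphD scalerDl. Qed.

HB.instance Definition _ := GRing.Zmodule_isLmodule.Build R (realified H)
  rscaleA rscale1 rscaleDr rscaleDl.

Let rnormD (x y : realified H) :
  rnorm (x + y : H) <= rnorm (x : H) + rnorm (y : H).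
Proof. by rewrite /rnorm -scalar_ReD; exact/scalar_Re_le/ler_normD. Qed.

Let rnormZ (a : R) (x : realified H) :
  rnorm (a *: x : H) = `|a| * rnorm (x : H).
Proof.
rewrite /rnorm [X in `|X|](_ : _ = of_real a *: (x : H)) // normrZ.
by rewrite scalar_Re_normM norm_of_real scalar_Re_of_real.
Qed.

Let rnorm0_eq0 (x : realified H) : rnorm (x : H) = 0 -> x = 0.
Proof.
move=> x0; apply: (@normr0_eq0 _ H).
by rewrite -[LHS]ge0_scalar_ReK // -/(rnorm (x : H)) x0 rmorph0.
Qed.

HB.instance Definition _ := Lmodule_isNormed.Build R (realified H)
  rnormD rnormZ rnorm0_eq0.

End Realified.

Section Operators.
Context {R : realType} {k : scalar_kind}.

(* An unbounded operator is given by its domain [D] and a total function [T]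
   whose values outside [D] are irrelevant. *)

(* [adjoint_graph D T w y] means that [w \in dom T*] and [T* w = y]. *)
Definition adjoint_graph {H Y : hilbertType R k} (D : set H) (T : H -> Y)
    (w : Y) (y : H) : Prop :=
  forall x, D x -> inner (T x) w = inner x y.

(* Adjoint of an everywhere defined bounded operator: the value exists and is
   unique by the Riesz representation theorem. *)
Definition adjoint {H Y : hilbertType R k} (T : H -> Y) (w : Y) : H :=
  get (adjoint_graph setT T w).

(* Only the operators [S t] with [0 <= t] are constrained. *)
Definition c0_semigroup {H : hilbertType R k} (S : R -> {linear H -> H}) : Prop :=
  [/\ forall t, 0 <= t -> continuous (S t),
      forall x, S 0 x = x,
      forall s t x, 0 <= s -> 0 <= t -> S (s + t) x = S s (S t x) &
      forall x, S t x @[t --> 0^'+] --> x].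

(* The generator is determined together with its domain: [D] is the set of
   points at which the right derivative at 0 exists. *)
Definition infinitesimal_generator {H : hilbertType R k}
    (S : R -> {linear H -> H}) (D : set H) (A : H -> H) : Prop :=
  forall x y, (D x /\ A x = y) <->
    of_real t^-1 *: (S t x - x) @[t --> 0^'+] --> y.

Definition generates_c0_semigroup {H : hilbertType R k}
    (D : set H) (A : H -> H) : Prop :=
  exists2 S : R -> {linear H -> H},
    c0_semigroup S & infinitesimal_generator S D A.

End Operators.

Section Dissipativity.
Context {R : realType} {k : scalar_kind} {H U Y Z : hilbertType R k}.

Definition stage_cost (C : H -> Y) (K : U -> Z) (z : H) (v : U)
    (x : H) (u : U) : R :=
  rnorm (C x) ^+ 2 + rnorm (K u) ^+ 2
  + 2 * scalar_Re (inner z x) + 2 * scalar_Re (inner v u).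

Definition controlled_equilibrium (D : set H) (A : H -> H) (B : U -> H)
    (xe : H) (ue : U) : Prop :=
  D xe /\ A xe + B ue = 0.

(* Only the restriction of [alpha] to the half-line matters. *)
Definition classK (alpha : R -> R) : Prop :=
  [/\ {within `[0, +oo[, continuous alpha},
      {in `[0, +oo[ &, {homo alpha : r s / r < s}} &
      alpha 0 = 0].

Definition real_diff (V : H -> R) (x : H) : H -> R :=
  'd (V : realified H -> R) (x : realified H).

Definition storage_function (V : H -> R) : Prop :=
  (forall x : realified H, differentiable (V : realified H -> R) x) /\
  (* continuity of the derivative with respect to the operator norm *)
  (forall (x : realified H) (e : R), 0 < e ->
     \forall y \near x,
       forall h, `|real_diff V y h - real_diff V x h| <= e * rnorm h).

Definition strictly_pre_dissipative (D : set H) (A : H -> H) (B : U -> H)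
    (ell : H -> U -> R) (xe : H) (ue : U) (V : H -> R) : Prop :=
  storage_function V /\
  exists2 alpha : R -> R, classK alpha &
    forall x u, D x ->
      real_diff V x (A x + B u)
        <= ell x u - ell xe ue - alpha (rnorm (x - xe)).

(* The inner product [<Q x, x>] is real when [Q] is self-adjoint. *)
Definition quadratic_storage (Q : H -> H) (w : H) (x : H) : R :=
  scalar_Re (inner (Q x) x) + 2 * scalar_Re (inner w x).

End Dissipativity.

(* Main.v *)
Require Import Defs.
From HB Require Import structures.
From mathcomp Require Import all_boot all_order all_algebra.
From mathcomp Require Import sesquilinear complex ring lra.
From mathcomp Require Import boolp classical_sets functions reals.
From mathcomp Require Import topology normedtype landau derive.

(** Write [x = xe + h] and [u = ue + g].  Because [A xe + B ue = 0], the dynamics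
    become [A h + B g], and expanding the squares gives
    [l(x,u) - l(xe,ue) = |C h|^2 + |K g|^2 + 2 Re <z',h> + 2 Re <v',g>]
    with [z' = z + C* C xe] and [v' = v + K* K ue].  The derivative of the storage
    function at [x] is [2 Re <gamma P h + w', . >] with [w' = w + gamma P xe].
    So pre-dissipativity compares a quadratic form in [(h,g)] with a linear one
    ([strictly_pre_dissipative_shift]), and each can be treated separately.

    Necessity of the two conditions: replace [(h,g)] by [(t h, t g)].  A
    quadratic form [t^2 q - 2 t l] that is nonnegative for all real [t] has
    [l = 0], so [Re <w', A h + B g> = Re <z',h> + Re <v',g>]: this says
    [A* w' = z'] and [B* w' = v'].  What is left, for [g = 0] and [h] scaled to
    norm one, is the coercivity estimate with [eta = gamma] and [m = alpha 1].

    Sufficiency: take [w = wt - gamma P xe], with [wt] the given preimage, so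
    that the linear parts cancel.  Multiplying the coercivity estimate by
    [gamma / eta <= 1] leaves the margin [gamma m / eta |h|^2], linear in
    [gamma], while the cross term [2 gamma Re <P h, B g>] costs, after
    completing the square against [|K g|^2], only [O(gamma^2) |h|^2].  A small
    [gamma] therefore gives a quadratic dissipation rate
    ([small_gain_inequality]).

    Adjoints are specified as a choice among solutions of the adjoint equation,
    so the proof needs that solutions exist.  This is the Riesz representation
    theorem, obtained below for real-linear functionals and the real inner
    product [Re <x,y>], which serves real and complex spaces at once. *)

Import Order.TTheory GRing.Theory Num.Theory.
Import numFieldNormedType.Exports.
Local Open Scope classical_set_scope.
Local Open Scope ring_scope.

(** * Real inequalities *)

(** This discriminant bound drives both the Cauchy-Schwarz inequality and the
    Riesz representation theorem. *)
Lemma sqr_le_discriminant (R : realFieldType) (a b c : R) : 0 <= c ->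
  (forall t, 0 <= a + 2 * t * b + t ^+ 2 * c) -> b ^+ 2 <= a * c.
Proof.
rewrite le_eqVlt => /predU1P[<-|c0] q.
  have [->|b0] := eqVneq b 0; first by rewrite expr0n mulr0.
  (* [c = 0]: this [t] makes the affine function equal to [-1] *)
  have := q (- (a + 1) / (2 * b)).
  have -> : a + 2 * (- (a + 1) / (2 * b)) * b + (- (a + 1) / (2 * b)) ^+ 2 * 0
    = - 1 by field.
  by rewrite ler0N1.
have := q (- b / c).
have -> : a + 2 * (- b / c) * b + (- b / c) ^+ 2 * c = (a * c - b ^+ 2) / c.
  by field; rewrite gt_eqF.
by rewrite pmulr_lge0 ?invr_gt0// subr_ge0.
Qed.

Lemma quadratic_ge0_linear_eq0 (R : realFieldType) (l q : R) :
  (forall t, 0 <= t ^+ 2 * q - 2 * t * l) -> 0 <= q /\ l = 0.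
Proof.
move=> ql; have q0 : 0 <= q by have := ql 1; have := ql (-1); lra.
split=> //; apply/eqP; rewrite -sqrf_eq0 eq_le sqr_ge0 andbT -(mul0r q) -sqrrN.
by apply: sqr_le_discriminant => // t; have := ql t; lra.
Qed.

(** In the application [a], [b], [n] are the norms of [C h], [K g], [h], while
    [s] and [x] are [Re <P h, A h>] and [Re <P h, B g>].  The second term of the
    minimum makes the loss [(gamma p / c)^2] from completing the square at most
    half of the margin [gamma m / eta]. *)
Lemma small_gain_inequality (R : realFieldType) (eta m p c a b n s x : R)
    (gamma := Num.min eta (m * c ^+ 2 / (2 * eta * p ^+ 2))) :
  0 < eta -> 0 < m -> 0 < p -> 0 < c ->
  m * n ^+ 2 <= a ^+ 2 - 2 * eta * s -> x <= p * n * (b / c) ->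
  2 * gamma * s + 2 * gamma * x
    <= a ^+ 2 + b ^+ 2 - gamma * m / (2 * eta) * n ^+ 2.
Proof.
move=> eta0 m0 p0 c0 coer cross.
have gamma0 : 0 < gamma by rewrite lt_min eta0 divr_gt0 ?mulr_gt0 ?exprn_gt0.
have gle : gamma <= eta by rewrite ge_min lexx.
have gp : gamma ^+ 2 * p ^+ 2 / c ^+ 2 <= gamma * m / (2 * eta).
  have : gamma <= m * c ^+ 2 / (2 * eta * p ^+ 2) by rewrite ge_min lexx orbT.
  rewrite !ler_pdivlMr ?mulr_gt0 ?exprn_gt0// => gmc.
  by rewrite mulrAC ler_pdivrMr ?exprn_gt0//; nra.
have diag : 2 * gamma * s <= a ^+ 2 - gamma * m / eta * n ^+ 2.
  have r0 : 0 <= gamma / eta by rewrite divr_ge0// ltW.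
  have r1 : gamma / eta <= 1 by rewrite ler_pdivrMr// mul1r.
  have -> : 2 * gamma * s = gamma / eta * (2 * eta * s).
    by field; rewrite gt_eqF.
  have -> : gamma * m / eta * n ^+ 2 = gamma / eta * (m * n ^+ 2).
    by field; rewrite gt_eqF.
  have := ler_wpM2r (sqr_ge0 a) r1; rewrite mul1r.
  by have := ler_wpM2l r0 coer; rewrite mulrBr; lra.
have offdiag : 2 * gamma * x <= b ^+ 2 + gamma * m / (2 * eta) * n ^+ 2.
  have := ler_wpM2r (sqr_ge0 n) gp; have := ler_wpM2l (ltW gamma0) cross.
  have := sqr_ge0 (gamma * p / c * n - b).
  have -> : gamma * (p * n * (b / c)) = gamma * p / c * n * b.
    by field; rewrite gt_eqF.
  have -> : gamma ^+ 2 * p ^+ 2 / c ^+ 2 * n ^+ 2 = (gamma * p / c * n) ^+ 2.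
    by field; rewrite gt_eqF.
  by rewrite sqrrB; lra.
have half : gamma * m / (2 * eta) = gamma * m / eta / 2.
  by field; rewrite gt_eqF.
by rewrite half in offdiag *; lra.
Qed.

(** * The real inner product *)

Section RealInner.
Context {R : realType} {k : scalar_kind}.

Lemma scalar_Re_conj (a : scalar_field R k) :
  scalar_Re (scalar_conj a) = scalar_Re a.
Proof. by case: k a => // -[]. Qed.

Lemma scalar_Re_of_realM (a : R) (s : scalar_field R k) :
  scalar_Re (of_real a * s) = a * scalar_Re s.
Proof. by case: k s => // -[x y] /=; rewrite mul0r subr0. Qed.

(** Taking [c] conjugate to [s] shows this without naming the imaginary unit,
    hence for both kinds of scalars. *)
Lemma scalar_Re_mulr_eq0 (s : scalar_field R k) :
  (forall c : scalar_field R k, scalar_Re (c * s) = 0) -> s = 0.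
Proof.
move=> s0; have := s0 (scalar_conj s); move: s {s0}; case: k => [x|[x y]] /=.
  by move/eqP; rewrite mulf_eq0 orbb => /eqP.
move/eqP; rewrite mulNr opprK -!expr2 paddr_eq0 ?sqr_ge0// !sqrf_eq0.
by case/andP => /eqP -> /eqP ->.
Qed.

Context {H : hilbertType R k}.
Implicit Types x y z h : H.

Definition rdot x y : R := scalar_Re (inner x y).

Lemma innerC x y : inner x y = scalar_conj (inner y x).
Proof. by rewrite hermC expr0 mul1r. Qed.

Lemma rdotC x y : rdot x y = rdot y x.
Proof. by rewrite /rdot innerC scalar_Re_conj. Qed.

Lemma rdotDl y x x' : rdot (x + x') y = rdot x y + rdot x' y.
Proof. by rewrite /rdot linearDl scalar_ReD. Qed.

Lemma innerZl (c : scalar_field R k) x y : inner (c *: x) y = c * inner x y.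
Proof. by rewrite linearZl_LR. Qed.

Lemma rdotZl a x y : rdot (of_real a *: x) y = a * rdot x y.
Proof. by rewrite /rdot innerZl scalar_Re_of_realM. Qed.

Lemma rdotNl x y : rdot (- x) y = - rdot x y.
Proof. by rewrite -scaleN1r -[-1](rmorphN1 (@of_real R k)) rdotZl mulN1r. Qed.

Lemma rdotDr x y y' : rdot x (y + y') = rdot x y + rdot x y'.
Proof. by rewrite !(rdotC x) rdotDl. Qed.

Lemma rdotZr a x y : rdot x (of_real a *: y) = a * rdot x y.
Proof. by rewrite !(rdotC x) rdotZl. Qed.

Lemma rdotNr x y : rdot x (- y) = - rdot x y.
Proof. by rewrite !(rdotC x) rdotNl. Qed.

Lemma rdot0r x : rdot x 0 = 0.
Proof. by rewrite /rdot linear0 -(rmorph0 (@of_real R k)) scalar_Re_of_real. Qed.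

Lemma rdotxx x : rdot x x = rnorm x ^+ 2.
Proof.
rewrite /rdot -inner_normE /rnorm !expr2.
by have := scalar_Re_normM `|x| `|x|; rewrite normr_id.
Qed.

Lemma rnorm_ge0 {V : normedModType (scalar_field R k)} (x : V) : 0 <= rnorm x.
Proof. exact: (@normr_ge0 _ (realified V)). Qed.

Lemma rnorm0 {V : normedModType (scalar_field R k)} : rnorm (0 : V) = 0.
Proof. exact: (@normr0 _ (realified V)). Qed.

Lemma rnormZ {V : normedModType (scalar_field R k)} (a : R) (x : V) :
  rnorm (of_real a *: x) = `|a| * rnorm x.
Proof. exact: (@normrZ R (realified V)). Qed.

Lemma rdot_le_norm x y : `|rdot x y| <= rnorm x * rnorm y.
Proof.
rewrite -(ler_sqr (normr_ge0 _)) ?nnegrE ?mulr_ge0 ?rnorm_ge0//.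
rewrite real_normK ?num_real// exprMn -!rdotxx.
apply: sqr_le_discriminant => [|t]; first by rewrite rdotxx sqr_ge0.
suff <- : rdot (x + of_real t *: y) (x + of_real t *: y) =
    rdot x x + 2 * t * rdot x y + t ^+ 2 * rdot y y.
  by rewrite rdotxx sqr_ge0.
by rewrite !(rdotDl, rdotDr, rdotZl, rdotZr) (rdotC y x); ring.
Qed.

End RealInner.

(** * Limits and bounded operators in terms of the real norm *)

Section RealNormTopology.
Context {R : realType} {k : scalar_kind}.

Lemma of_real_lt (a b : R) :
  (of_real a < of_real b :> scalar_field R k) = (a < b).
Proof. by case: k => //=; rewrite ltcR. Qed.

Lemma of_real_le (a b : R) :
  (of_real a <= of_real b :> scalar_field R k) = (a <= b).
Proof. by case: k => //=; rewrite lecR. Qed.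

Lemma normr_rnorm {V : normedModType (scalar_field R k)} (x : V) :
  `|x| = of_real (rnorm x).
Proof. by rewrite ge0_scalar_ReK. Qed.

Lemma cvg_rnormP {V : normedModType (scalar_field R k)} {I : Type}
    {F : set_system I} {FF : Filter F} (f : I -> V) (y : V) :
  f @ F --> y <-> forall e : R, 0 < e -> \forall x \near F, rnorm (y - f x) < e.
Proof.
split=> [/cvgrPdist_lt fy e e0|fy].
  have := fy (of_real e).
  rewrite -{1}(rmorph0 (@of_real R k)) of_real_lt => /(_ e0).
  by apply: filterS => x; rewrite normr_rnorm of_real_lt.
apply/cvgrPdist_lt => e e0.
have := fy (scalar_Re e); rewrite -(@of_real_lt 0) rmorph0 ge0_scalar_ReK 1?ltW//.
move=> /(_ e0); apply: filterS => x ?.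
by rewrite normr_rnorm -[X in _ < X](ge0_scalar_ReK (ltW e0)) of_real_lt.
Qed.

Lemma continuous_rnorm_bounded {V W : normedModType (scalar_field R k)}
    (T : {linear V -> W}) :
  continuous T -> exists2 M : R, 0 < M & forall x, rnorm (T x) <= M * rnorm x.
Proof.
move=> /linear_bounded_continuous/linear_boundedP [M [Mreal TM]].
have M0 : 0 < `|M| + 1 by rewrite ltr_wpDl.
have ME := ge0_scalar_ReK (ltW M0).
exists (scalar_Re (`|M| + 1)); first by rewrite -(@of_real_lt 0) rmorph0 ME.
move=> x; rewrite -of_real_le rmorphM /= ME -!normr_rnorm.
by apply: TM; rewrite (le_lt_trans (real_ler_norm Mreal))// ltrDl.
Qed.

End RealNormTopology.

(** * Riesz representation and adjoints *)

Section Riesz.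
Context {R : realType} {k : scalar_kind} {H : hilbertType R k}.
Variables (f : H -> R) (M : R).
Hypothesis f_linear : forall a x y, f (of_real a *: x + y) = a * f x + f y.
Hypothesis f_bounded : forall x, `|f x| <= M * rnorm x.

(** If [J x] is within [e^2] of the infimum of [J x = |x|^2 - 2 f x], then
    [t |-> J (x + t h) - J x + e^2] is a nonnegative quadratic polynomial for
    every [h], and its discriminant gives the bound. *)
Lemma riesz_approx (e : R) : 0 < e ->
  exists x : H, forall h, `|rdot x h - f h| <= e * rnorm h.
Proof.
move=> e0; pose J (x : H) := rnorm x ^+ 2 - 2 * f x.
have JM : has_inf (range J).
  split; first by exists (J 0), 0.
  exists (- M ^+ 2) => _ [x _ <-]; rewrite /J.
  by have := f_bounded x; have := sqr_ge0 (M - rnorm x); rewrite ler_norml; nra.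
have [_ [x _ <-] Jx] := inf_adherent (exprn_gt0 2 e0) JM.
exists x => h.
rewrite -(ler_sqr (normr_ge0 _)) ?nnegrE ?mulr_ge0 ?rnorm_ge0 ?(ltW e0)//.
rewrite real_normK ?num_real// exprMn.
apply: sqr_le_discriminant => [|t]; first exact: sqr_ge0.
have : inf (range J) <= J (of_real t *: h + x).
  by apply: ge_inf; [case: JM|exists (of_real t *: h + x)].
move: Jx => /[swap] Jinf Jx.
have {Jinf Jx} := lt_le_trans Jx (lerD Jinf (lexx _)).
rewrite /J f_linear -!rdotxx !(rdotDl, rdotDr, rdotZl, rdotZr) (rdotC h x).
lra.
Qed.

(** Two [e]-approximate representers of [f] are at distance at most [2 e], as
    one sees by testing both with [h] their difference.  So the sets of
    approximate representers form a Cauchy filter, whose limit represents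
    [f]. *)
Lemma riesz_representation : exists y : H, forall x, rdot x y = f x.
Proof.
pose G (e : R) := [set x : H | forall h, `|rdot x h - f h| <= e * rnorm h].
pose F := filter_from [set e : R | 0 < e] G.
have GS e e' : e <= e' -> G e `<=` G e'.
  by move=> ee' x Gx h; rewrite (le_trans (Gx h)) ?ler_wpM2r ?rnorm_ge0.
have FP : ProperFilter F.
  apply: filter_from_proper; last by move=> e /riesz_approx.
  apply: filter_from_filter; first by exists 1 => /=.
  move=> e e' /= e0 e'0; exists (Num.min e e'); first by rewrite /= lt_min e0.
  by move=> x Gx; split; apply: GS Gx; rewrite ge_min lexx ?orbT.
have diam e x y : 0 < e -> G e x -> G e y -> rnorm (x - y) <= 2 * e.
  move=> e0 Gx Gy; have := Gx (x - y); have := Gy (x - y); rewrite !ler_norml.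
  have := rdotxx (x - y); rewrite {1}rdotDl rdotNl => dxy /andP[? ?] /andP[? ?].
  have := rnorm_ge0 (x - y); rewrite le_eqVlt => /predU1P[<-|xy0].
    by rewrite mulr_ge0// ltW.
  by rewrite -(ler_pM2r xy0); lra.
have /cauchy_cvg/cvg_ex[y Fy] : cauchy F.
  apply/cauchyP => e e0; have e'0 : 0 < scalar_Re e.
    by rewrite -(@of_real_lt R k 0) rmorph0 ge0_scalar_ReK // ltW.
  have [|x Gx] := @riesz_approx (scalar_Re e / 4); first by rewrite divr_gt0.
  exists x; exists (scalar_Re e / 4) => [|y Gy] /=; first by rewrite /= divr_gt0.
  rewrite -ball_normE /= normr_rnorm -(ge0_scalar_ReK (ltW e0)) of_real_lt.
  by rewrite (le_lt_trans (diam _ _ _ _ Gx Gy)) ?divr_gt0//; lra.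
exists y => h; apply/eqP; rewrite -subr_eq0 -normr_le0.
apply/ler_addgt0Pl => e e0; rewrite addr0.
(* the [+ 1] avoids a division by zero when [h = 0] *)
have d0 : 0 < e / (2 * (rnorm h + 1)).
  by rewrite divr_gt0// mulr_gt0// ltr_wpDl ?rnorm_ge0.
have : F (G (e / (2 * (rnorm h + 1)))) by exists (e / (2 * (rnorm h + 1))).
have /cvg_rnormP/(_ _ d0) yx : id @ F --> y by [].
move/(filterI yx)/filter_ex => [x [/= xy Gx]].
rewrite (rdotC h).
have -> : rdot y h - f h = rdot (y - x) h + (rdot x h - f h).
  by rewrite rdotDl rdotNl; ring.
rewrite (le_trans (ler_normD _ _))//.
rewrite (le_trans (lerD (rdot_le_norm _ _) (Gx h)))//.
rewrite -mulrDl; have h0 := rnorm_ge0 h.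
have : (rnorm (y - x) + e / (2 * (rnorm h + 1))) * rnorm h <=
   (2 * (e / (2 * (rnorm h + 1)))) * (rnorm h + 1).
  by rewrite ler_pM ?addr_ge0 ?rnorm_ge0 1?ltW//; lra.
move/le_trans; apply; rewrite le_eqVlt; apply/orP; left; apply/eqP; field.
by rewrite gt_eqF// ltr_wpDl.
Qed.

End Riesz.

Section RealInnerEquations.
Context {R : realType} {k : scalar_kind} {H : hilbertType R k}.

(** Testing at all the multiples [c *: x], and not only at [x], recovers the
    imaginary parts. *)
Lemma adjoint_graph_of_rdot {Y : hilbertType R k} (D : set H) (T : H -> Y)
    (w : Y) (y : H) :
  (forall c x, D x -> D (c *: x) /\ T (c *: x) = c *: T x) ->
  (forall x, D x -> rdot (T x) w = rdot x y) ->
  adjoint_graph D T w y.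
Proof.
move=> DT Twy x Dx; apply/eqP; rewrite -subr_eq0; apply/eqP.
apply: scalar_Re_mulr_eq0 => c; have [Dc Tc] := DT c x Dx.
rewrite mulrBr -!innerZl -Tc.
have := Twy _ Dc; rewrite /rdot => /eqP; rewrite -subr_eq0 => /eqP <-.
rewrite scalar_ReD -[- inner _ _]mulN1r -(rmorphN1 (@of_real R k)).
by rewrite scalar_Re_of_realM mulN1r.
Qed.

End RealInnerEquations.

Section Adjoint.
Context {R : realType} {k : scalar_kind} {H Y : hilbertType R k}.
Variable T : {linear H -> Y}.

Lemma adjoint_unique (w : Y) (y : H) :
  (forall x, inner (T x) w = inner x y) -> adjoint T w = y.
Proof.
move=> Ty; apply: get_unique => // y' Ty'.
have d0 : rdot (y' - y) (y' - y) = 0.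
  by rewrite rdotDr rdotNr /rdot -Ty' // -Ty subrr.
apply/eqP; rewrite -subr_eq0; apply/eqP; apply: (@normr0_eq0 _ H).
rewrite normr_rnorm; apply/eqP; rewrite fmorph_eq0.
by have/eqP := d0; rewrite rdotxx sqrf_eq0.
Qed.

Lemma adjointP (w : Y) : continuous T -> adjoint_graph setT T w (adjoint T w).
Proof.
move=> /continuous_rnorm_bounded[M M0 TM].
have [|x|y yT] :=
  @riesz_representation R k H (fun x => rdot (T x) w) (M * rnorm w).
- by move=> a x y; rewrite linearD linearZ /= rdotDl rdotZl.
- by rewrite (le_trans (rdot_le_norm _ _))// mulrAC ler_wpM2r ?rnorm_ge0//.
apply: (@getPex _ (adjoint_graph setT T w)); exists y.
apply: adjoint_graph_of_rdot => [c x _|x _]; first by rewrite linearZ.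
by rewrite -yT rdotC.
Qed.

End Adjoint.

(** * Linearity of the generator *)

Section Generator.
Context {R : realType} {k : scalar_kind} {H : hilbertType R k}.
Variables (D : set H) (A : H -> H).
Hypothesis hA : generates_c0_semigroup D A.

Lemma generator_linear (c : scalar_field R k) (x y : H) : D x -> D y ->
  D (c *: x + y) /\ A (c *: x + y) = c *: A x + A y.
Proof.
case: hA => S _ gS Dx Dy; apply/gS.
have /gS Sx : D x /\ A x = A x by [].
have /gS Sy : D y /\ A y = A y by [].
have -> : (fun t : R => of_real t^-1 *: (S t (c *: x + y) - (c *: x + y))) =
    (c \*: (fun t : R => of_real t^-1 *: (S t x - x))) +
    (fun t : R => of_real t^-1 *: (S t y - y)).
  apply/funext => t; rewrite !fctE (linearP (S t)) /= scalerA [c * _]mulrC.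
  rewrite -scalerA -scalerDr; congr (_ *: _).
  by rewrite scalerBr opprD addrACA.
exact: cvgD (cvgZl_tmp (k := c) Sx) Sy.
Qed.

Lemma generator_dom0 : D 0.
Proof.
case: hA => S _ gS; have [] // := (gS 0 0).2.
suff -> : (fun t => of_real t^-1 *: (S t 0 - 0)) = cst 0 by exact: cvg_cst.
by apply/funext => t; rewrite linear0 subr0 scaler0.
Qed.

Lemma generator0 : A 0 = 0.
Proof.
have := (generator_linear 1 _ _ generator_dom0 generator_dom0).2.
by rewrite !scale1r addr0 -[LHS]addr0 => /addrI /esym.
Qed.

Lemma generatorZ (c : scalar_field R k) (x : H) : D x ->
  D (c *: x) /\ A (c *: x) = c *: A x.
Proof.
move=> Dx; have := generator_linear c _ _ Dx generator_dom0.
by rewrite generator0 !addr0.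
Qed.

End Generator.

(** * Differentiability of quadratic storage functions *)

Section QuadraticStorage.
Context {R : realType} {k : scalar_kind} {H : hilbertType R k}.

(** A copy of [rdot w] whose source is the underlying real space, to carry the
    real-linear structure that a derivative must have. *)
Definition rdot_realified (w : H) : realified H -> R := rdot w.

Fact rdot_realified_linear w : linear (rdot_realified w : realified H -> R^o).
Proof. by move=> a x y; rewrite /rdot_realified rdotDr rdotZr. Qed.

HB.instance Definition _ w := GRing.isLinear.Build R (realified H) R^o _
  (rdot_realified w) (rdot_realified_linear w).

Lemma continuous_rdot_realified w :
  continuous (rdot_realified w : realified H -> R^o).
Proof.
apply/linear_bounded_continuous/linear_boundedP.
exists (rnorm w); split=> [|r wr x]; first exact: num_real.
by rewrite (le_trans (rdot_le_norm _ _))// ler_wpM2r ?rnorm_ge0// ltW.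
Qed.

Variables (Q : {linear H -> H}) (w : H) (M : R).
Hypothesis M0 : 0 < M.
Hypothesis Q_bounded : forall x, rnorm (Q x) <= M * rnorm x.
Hypothesis Q_sym : forall x y, rdot (Q x) y = rdot (Q y) x.

Let V : realified H -> R := quadratic_storage Q w.

(** The remainder is exactly [Re <Q h, h>], which is [O(|h|^2)]. *)
Lemma quadratic_storage_expansion (x : realified H) :
  V \o shift x = cst (V x) + rdot_realified (of_real 2 *: (Q x + w)) +o_ 0 id.
Proof.
apply/eqaddoP => e e0; near=> h.
have -> : (V \o shift x - (cst (V x) + rdot_realified (of_real 2 *: (Q x + w)))) h
   = rdot (Q h) h.
  rewrite /= /V /quadratic_storage !fctE /rdot_realified -!/(rdot _ _) linearD.
  rewrite !(rdotDl, rdotDr, rdotZl) (Q_sym h x); ring.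
rewrite (le_trans (rdot_le_norm _ _))// ler_wpM2r ?rnorm_ge0//.
rewrite (le_trans (Q_bounded _))// -ler_pdivlMl// mulrC.
apply: ltW; near: h.
have : 0 < e / M by rewrite divr_gt0.
exact: (@nbhs0_lt _ (realified H)).
Unshelve. all: by end_near. Qed.

Lemma real_diff_quadratic_storage (x h : H) :
  real_diff (quadratic_storage Q w) x h = 2 * rdot (Q x + w) h.
Proof.
have := diff_unique (@continuous_rdot_realified _)
  (quadratic_storage_expansion x).
by rewrite /real_diff => -> /=; rewrite /rdot_realified rdotZl.
Qed.

Lemma quadratic_storage_C1 : storage_function (quadratic_storage Q w).
Proof.
split=> [x|x e e0].
  apply/diff_locallyP.
  rewrite (diff_unique (@continuous_rdot_realified _)
    (quadratic_storage_expansion x)).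
  by split; [exact: continuous_rdot_realified|exact: quadratic_storage_expansion].
have d0 : 0 < e / (2 * M) by rewrite divr_gt0// mulr_gt0.
have /cvgrPdist_lt/(_ _ d0) xx : (id : realified H -> realified H) @ x --> x.
  exact: cvg_id.
near=> y; move=> h.
rewrite !real_diff_quadratic_storage -mulrBr -rdotNl -rdotDl.
have -> : Q y + w - (Q x + w) = Q (y - x).
  by rewrite (linearB Q) opprD addrACA subrr addr0.
rewrite normrM ger0_norm//.
have yx : rnorm (x - y : H) < e / (2 * M).
  by near: y; exact: xx.
apply: (@le_trans _ _ (2 * (M * (e / (2 * M)) * rnorm h))); last first.
  by rewrite le_eqVlt; apply/orP; left; apply/eqP; field; rewrite gt_eqF.
rewrite ler_wpM2l// (le_trans (rdot_le_norm _ _))// ler_wpM2r ?rnorm_ge0//.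
rewrite (le_trans (Q_bounded _))// ler_wpM2l ?(ltW M0)//.
rewrite [rnorm _](_ : _ = rnorm (x - y : H)) ?ltW//.
exact: (@distrC _ (realified H)).
Unshelve. all: by end_near. Qed.

End QuadraticStorage.

(** * Shift to the equilibrium *)

Section Reduction.
Context {R : realType} {k : scalar_kind} {H U Y Z : hilbertType R k}.
Variables (C : {linear H -> Y}) (K : {linear U -> Z}) (z : H) (v : U).
Hypotheses (hC : continuous C) (hK : continuous K).
Variables (xe : H) (ue : U).

Lemma stage_cost_shift (h : H) (g : U) :
  stage_cost C K z v (xe + h) (ue + g) - stage_cost C K z v xe ue =
  rnorm (C h) ^+ 2 + rnorm (K g) ^+ 2 + 2 * rdot (z + adjoint C (C xe)) h
  + 2 * rdot (v + adjoint K (K ue)) g.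
Proof.
have CE : rdot (adjoint C (C xe)) h = rdot (C h) (C xe).
  by rewrite rdotC /rdot (adjointP C (C xe) hC h I).
have KE : rdot (adjoint K (K ue)) g = rdot (K g) (K ue).
  by rewrite rdotC /rdot (adjointP K (K ue) hK g I).
rewrite /stage_cost -!/(rdot _ _) !(rdotDl _ _ (adjoint _ _)) CE KE.
rewrite -!rdotxx (linearD C) (linearD K) !(rdotDl, rdotDr).
rewrite (rdotC (C xe) (C h)) (rdotC (K ue) (K g)); ring.
Qed.

Variables (D : set H) (A : H -> H) (B : {linear U -> H}).
Hypothesis hA : generates_c0_semigroup D A.
Hypothesis he : controlled_equilibrium D A B xe ue.
Variable P : {linear H -> H}.
Hypotheses (hP : continuous P) (hPsa : adjoint P =1 P).

(** The equation for [adjoint P y] is available only because it is solvable;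
    this is where the Riesz theorem enters the treatment of [P]. *)
Lemma self_adjoint_rdot (x y : H) : rdot (P x) y = rdot (P y) x.
Proof. by rewrite /rdot (adjointP P y hP x I) hPsa innerC scalar_Re_conj. Qed.

(** After the shift both sides split into a quadratic and a linear part in
    [(h,g)], with no constant term. *)
Lemma strictly_pre_dissipative_shift (gamma : R) (w : H) :
  strictly_pre_dissipative D A B (stage_cost C K z v) xe ue
    (quadratic_storage (fun x => of_real gamma *: P x) w) <->
  exists2 alpha : R -> R, classK alpha & forall h g, D h ->
    2 * gamma * rdot (P h) (A h + B g)
      + 2 * rdot (w + of_real gamma *: P xe) (A h + B g)
    <= rnorm (C h) ^+ 2 + rnorm (K g) ^+ 2 + 2 * rdot (z + adjoint C (C xe)) h
       + 2 * rdot (v + adjoint K (K ue)) g - alpha (rnorm h).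
Proof.
have [Dxe Axe] := he.
pose Q : {linear H -> H} := of_real gamma \*: P.
have [M M0 QM] : exists2 M : R, 0 < M & forall x, rnorm (Q x) <= M * rnorm x.
  apply: continuous_rnorm_bounded => x; exact: cvgZl_tmp (hP x).
have Qsym x y : rdot (Q x) y = rdot (Q y) x.
  by rewrite /Q /= !rdotZl self_adjoint_rdot.
have QC1 := quadratic_storage_C1 Q w M M0 QM Qsym.
have Qd := real_diff_quadratic_storage Q w M M0 QM Qsym.
have dE h g : D h ->
    real_diff (quadratic_storage Q w) (xe + h) (A (xe + h) + B (ue + g))
   = 2 * gamma * rdot (P h) (A h + B g)
      + 2 * rdot (w + of_real gamma *: P xe) (A h + B g).
  move=> Dh; rewrite Qd.
  have -> : A (xe + h) + B (ue + g) = A h + B g.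
    have [_] := generator_linear D A hA 1 _ _ Dxe Dh; rewrite !scale1r => ->.
    by rewrite linearD addrACA Axe add0r.
  by rewrite /Q /= linearD scalerDr !rdotDl !rdotZl; ring.
split=> [[_ [alpha aK diss]]|[alpha aK diss]].
  exists alpha => // h g Dh.
  rewrite -dE// -stage_cost_shift.
  have Dx : D (xe + h).
    by have [] := generator_linear D A hA 1 _ _ Dxe Dh; rewrite scale1r.
  by have := diss (xe + h) (ue + g) Dx; rewrite [xe + h - xe]addrC addKr.
split; first exact: QC1.
exists alpha => // x u Dx.
have Dh : D (x - xe).
  by have [] := generator_linear D A hA (-1) _ _ Dxe Dx; rewrite scaleN1r addrC.
have := diss (x - xe) (u - ue) Dh.
by rewrite -dE// -stage_cost_shift ![_ + (_ - _)]addrC !subrK.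
Qed.

End Reduction.

(** * Comparison functions *)

Lemma classK_ge0 (R : realType) (alpha : R -> R) (r : R) :
  classK alpha -> 0 <= r -> 0 <= alpha r.
Proof.
case=> _ amono a0; rewrite le_eqVlt => /predU1P[<-|r0]; first by rewrite a0.
by rewrite -a0 ltW// amono// in_itv/= ?lexx ?(ltW r0).
Qed.

Lemma classK_gt0 (R : realType) (alpha : R -> R) (r : R) :
  classK alpha -> 0 < r -> 0 < alpha r.
Proof.
by case=> _ amono a0 r0; rewrite -a0 amono// in_itv/= ?lexx ?(ltW r0).
Qed.

Lemma classK_sqr (R : realType) (d : R) : 0 < d -> classK (fun r => d * r ^+ 2).
Proof.
move=> d0; split.
- apply: continuous_subspaceT => r.
  by apply: cvgM; [exact: cvg_cst|exact: (cvgM cvg_id cvg_id)].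
- move=> r s; rewrite !in_itv/= !andbT => r0 s0 rs.
  by rewrite ltr_pM2l// ltr_sqr ?nnegrE.
- by rewrite expr0n mulr0.
Qed.

(** * The characterisation *)

Theorem theorem9 (R : realType) (k : scalar_kind) (H U Y Z : hilbertType R k)
    (domA : set H) (A : H -> H) (hA : generates_c0_semigroup domA A)
    (B : {linear U -> H}) (hB : continuous B)
    (C : {linear H -> Y}) (hC : continuous C)
    (K : {linear U -> Z}) (hK : continuous K)
    (z : H) (v : U)
    (hKB : exists2 cK : R, 0 < cK & forall u, cK * rnorm (B u) <= rnorm (K u))
    (P : {linear H -> H}) (hP : continuous P) (hPsa : adjoint P =1 P)
    (xe : H) (ue : U) (he : controlled_equilibrium domA A B xe ue) :
  (exists (gamma : R) (w : H), 0 < gamma /\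
     strictly_pre_dissipative domA A B (stage_cost C K z v) xe ue
       (quadratic_storage (fun x => of_real gamma *: P x) w))
  <->
  ((exists w : H,
      adjoint_graph domA A w (z + adjoint C (C xe)) /\
      adjoint B w = v + adjoint K (K ue)) /\
   (exists eta m : R, [/\ 0 < eta, 0 < m &
      forall x, domA x ->
        m * rnorm x ^+ 2
          <= rnorm (C x) ^+ 2 - 2 * eta * scalar_Re (inner (A x) (P x))])).
Proof.
have shift :=
  strictly_pre_dissipative_shift C K z v hC hK xe ue domA A B hA he P hP hPsa.
split.
- move=> [gamma [w [gamma0 /shift[alpha aK diss]]]].
  set z' := z + _ in diss *; set v' := v + _ in diss *.
  set w' := w + _ in diss.
  pose l h g := rdot w' (A h + B g) - rdot z' h - rdot v' g.
  pose q h g := rnorm (C h) ^+ 2 + rnorm (K g) ^+ 2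
    - 2 * gamma * rdot (P h) (A h + B g).
  have scaled h g t : domA h ->
      alpha (rnorm (of_real t *: h)) <= t ^+ 2 * q h g - 2 * t * l h g.
    move=> Dh; have [Dth Ath] := generatorZ domA A hA (of_real t) h Dh.
    have := diss (of_real t *: h) (of_real t *: g) Dth.
    rewrite Ath (linearZ_LR B) (linearZ_LR C) (linearZ_LR K) (linearZ_LR P) /=.
    rewrite -scalerDr -!rdotxx !(rdotZl, rdotZr) /l /q -!rdotxx; lra.
  have ql0 h g : domA h -> 0 <= q h g /\ l h g = 0.
    move=> Dh; apply: quadratic_ge0_linear_eq0 => t.
    by rewrite (le_trans _ (scaled _ _ _ Dh))// classK_ge0// rnorm_ge0.
  split.
    exists w'; split.
      apply: adjoint_graph_of_rdot => [c x|x Dx]; first exact: generatorZ hA c x.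
      have [_] := ql0 x 0 Dx; rewrite /l linear0 addr0 rdot0r.
      by rewrite (rdotC w') (rdotC z'); lra.
    apply: adjoint_unique => g.
    apply: (adjoint_graph_of_rdot setT B) => // [c x _|x _].
      by rewrite linearZ.
    have [_] := ql0 0 x (generator_dom0 _ _ hA).
    rewrite /l (generator0 _ _ hA) add0r rdot0r.
    by rewrite (rdotC w') (rdotC v'); lra.
  exists gamma, (alpha 1); split=> //; first exact: classK_gt0 aK ltr01.
  move=> x Dx; have [q0 l0] := ql0 x 0 Dx.
  have -> : rnorm (C x) ^+ 2 - 2 * gamma * scalar_Re (inner (A x) (P x)) = q x 0.
    by rewrite /q !linear0 rnorm0 expr0n !addr0 rdotC.
  have := rnorm_ge0 x; rewrite le_eqVlt => /predU1P[<-|x0].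
    by rewrite expr0n mulr0.
  (* [t = 1 / |x|] normalises [x], so that [alpha] is evaluated at [1] *)
  have := scaled x 0 (rnorm x)^-1 Dx; rewrite l0 mulr0 subr0.
  rewrite rnormZ normfV ger0_norm ?(ltW x0)// mulVf ?gt_eqF//.
  by rewrite exprVn ler_pdivlMl ?exprn_gt0// mulrC.
- move=> [[w [wA wB]] [eta [m [eta0 m0 coer]]]].
  have [c c0 cKB] := hKB.
  have [p p0 Pp] := continuous_rnorm_bounded P hP.
  pose gamma := Num.min eta (m * c ^+ 2 / (2 * eta * p ^+ 2)).
  have gamma0 : 0 < gamma.
    by rewrite lt_min eta0 divr_gt0 ?mulr_gt0 ?exprn_gt0.
  exists gamma, (w - of_real gamma *: P xe); split => //.
  apply/shift; exists (fun r => gamma * m / (2 * eta) * r ^+ 2).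
    by apply: classK_sqr; rewrite divr_gt0 ?mulr_gt0.
  move=> h g Dh; rewrite subrK.
  have -> : rdot w (A h + B g) =
      rdot (z + adjoint C (C xe)) h + rdot (v + adjoint K (K ue)) g.
    rewrite rdotDr -wB; congr (_ + _); rewrite rdotC [RHS]rdotC /rdot.
      by rewrite (wA h Dh).
    by rewrite (adjointP B w hB g I).
  have cross : rdot (P h) (B g) <= p * rnorm h * (rnorm (K g) / c).
    rewrite (le_trans (ler_norm _))// (le_trans (rdot_le_norm _ _))//.
    by rewrite ler_pM ?rnorm_ge0// ler_pdivlMr// mulrC.
  have := coer h Dh; rewrite -/(rdot _ _) (rdotC (A h)) => coerh.
  have := small_gain_inequality _ _ _ _ _ _ _ _ _ _ eta0 m0 p0 c0 coerh cross.
  by rewrite -/gamma rdotDr; lra.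
Qed.
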